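(* Let $\mathbf{V}$ be a variety of Heyting algebras such that the variety $\rho^*(\mathbf{V})$ of interior algebras generated by $\{\mathcal{B}(L): L \in \mathbf{V}\}$ is locally finite. Then for every $L \in \mathbf{V}$, the unification type of $L$ in $\mathbf{V}$ equals the unification type of $\mathcal{B}(L)$ in $\rho^*(\mathbf{V})$, i.e. $t^{\mathbf{V}}(L) = t^{\rho^*(\mathbf{V})}(\mathcal{B}(L))$.
   Context: An interior algebra is a Boolean algebra $B$ with an operator $g$ satisfying $g(1)=1$, $g(x\cdot y)=g(x)\cdot g(y)$, $g(x)\le x$, $g(g(x))=g(x)$. For a Heyting algebra $L$, $\mathcal{B}(L)$ is the interior algebra $\langle \mathrm{Fr}(L), g_L\rangle$, where $\mathrm{Fr}(L)$ is the free (minimal) Boolean extension of the bounded lattice $L$ (so every element has the form $(-u_1+v_1)\cdots(-u_n+v_n)$ with $u_i,v_i\in L$) and $g_L((-u_1+v_1)\cdots(-u_n+v_n)) = (u_1\Rightarrow v_1)\cdots(u_n\Rightarrow v_n)$; its open elements form a Heyting algebra isomorphic to $L$. Unification: for a variety $\mathbf{W}$ and a finitely presented $A\in\mathbf{W}$, a unifier of $A$ in $\mathbf{W}$ is a pair $\langle u,B\rangle$ with $B$ finitely presented and projective in $\mathbf{W}$ and $u\colon A\to B$ a homomorphism; $\langle u,B\rangle \succcurlyeq \langle v,C\rangle$ iff there is a homomorphism $h\colon B\to C$ with $v = h\circ u$. This is a quasiorder on the set $U^{\mathbf{W}}_A$ of unifiers. A $\mu$-set of a quasiordered set is a dense antichain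 (every element lies below some element of it). The unification type $t^{\mathbf{W}}(A)$ is $1$ if $U_A^{\mathbf{W}}$ has a $\mu$-set of cardinality $1$, $\omega$ if it has a finite $\mu$-set of cardinality $>1$, $\infty$ if it has an infinite $\mu$-set, and $0$ if it has no $\mu$-set. *)

(* Defs.v *)
From Stdlib Require Import List.
Import ListNotations.
Set Implicit Arguments.

Record Sig := MkSig {
  alg : Type;
  car : alg -> Type;
  tm  : Type;
  ev  : forall X : alg, (nat -> car X) -> tm -> car X;
  (* bnd n t : all variables of t are < n *)
  bnd : nat -> tm -> Prop;
  hom : forall X Y : alg, (car X -> car Y) -> Prop
}.

Section Generic.
Variable S : Sig.

Definition eq_valid (X : alg S) (e : tm S * tm S) : Prop :=
  forall v : nat -> car S X, ev S X v (fst e) = ev S X v (snd e).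

Definition is_variety (W : alg S -> Prop) : Prop :=
  exists E : tm S * tm S -> Prop,
    forall X, W X <-> (forall e, E e -> eq_valid X e).

Definition gen_variety (K : alg S -> Prop) : alg S -> Prop :=
  fun X => forall e, (forall Y, K Y -> eq_valid Y e) -> eq_valid X e.

Definition locally_finite (W : alg S -> Prop) : Prop :=
  forall X, W X -> forall (n : nat) (a : nat -> car S X),
    exists l : list (car S X), forall t, bnd S n t -> In (ev S X a t) l.

Definition fin_pres (W : alg S -> Prop) (A : alg S) : Prop :=
  W A /\
  exists (n : nat) (a : nat -> car S A) (rels : list (tm S * tm S)),
    (forall p, In p rels -> bnd S n (fst p) /\ bnd S n (snd p)) /\
    (forall p, In p rels -> ev S A a (fst p) = ev S A a (snd p)) /\
    (forall x, exists t, bnd S n t /\ ev S A a t = x) /\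
    (forall B, W B -> forall b : nat -> car S B,
       (forall p, In p rels -> ev S B b (fst p) = ev S B b (snd p)) ->
       exists f, hom S A B f /\ forall i, i < n -> f (a i) = b i).

Definition projective (W : alg S -> Prop) (B : alg S) : Prop :=
  W B /\
  forall C D, W C -> W D ->
  forall f : car S C -> car S D, hom S C D f ->
    (forall y, exists x, f x = y) ->
  forall h : car S B -> car S D, hom S B D h ->
    exists k : car S B -> car S C, hom S B C k /\ forall x, f (k x) = h x.

Record unifier (W : alg S -> Prop) (A : alg S) := MkUnifier {
  u_alg  : alg S;
  u_fp   : fin_pres W u_alg;
  u_proj : projective W u_alg;
  u_map  : car S A -> car S u_alg;
  u_hom  : hom S A u_alg u_map
}.

Definition more_general (W : alg S -> Prop) (A : alg S)
  (U V : unifier W A) : Prop :=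
  exists h : car S (u_alg U) -> car S (u_alg V),
    hom S (u_alg U) (u_alg V) h /\
    forall x, u_map V x = h (u_map U x).

Definition mu_set (W : alg S -> Prop) (A : alg S)
  (M : unifier W A -> Prop) : Prop :=
  (forall U V, M U -> M V -> more_general U V -> U = V) /\
  (forall V, exists U, M U /\ more_general U V).

Definition finite_set (T : Type) (M : T -> Prop) : Prop :=
  exists l : list T, forall x, M x -> In x l.

Inductive utype := T1 | Tomega | Tinf | T0.

Definition has_utype (W : alg S -> Prop) (A : alg S) (t : utype) : Prop :=
  match t with
  | T1 => exists M : unifier W A -> Prop, mu_set M /\
            exists U, forall V, M V <-> V = U
  | Tomega => exists M : unifier W A -> Prop, mu_set M /\ finite_set M /\
            exists U V, M U /\ M V /\ U <> V
  | Tinf => exists M : unifier W A -> Prop, mu_set M /\ ~ finite_set M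
  | T0 => ~ exists M : unifier W A -> Prop, mu_set M
  end.

End Generic.

Record HA := MkHA {
  hcar :> Type;
  hbot : hcar;  htop : hcar;
  hjoin : hcar -> hcar -> hcar;
  hmeet : hcar -> hcar -> hcar;
  himp  : hcar -> hcar -> hcar;
  hjoinC : forall x y, hjoin x y = hjoin y x;
  hmeetC : forall x y, hmeet x y = hmeet y x;
  hjoinA : forall x y z, hjoin x (hjoin y z) = hjoin (hjoin x y) z;
  hmeetA : forall x y z, hmeet x (hmeet y z) = hmeet (hmeet x y) z;
  hjoin_abs : forall x y, hjoin x (hmeet x y) = x;
  hmeet_abs : forall x y, hmeet x (hjoin x y) = x;
  hjoin_bot : forall x, hjoin x hbot = x;
  hmeet_top : forall x, hmeet x htop = x;
  (* x /\ y <= z  iff  x <= y => z, where a <= b := a /\ b = a *)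
  himp_adj : forall x y z,
    hmeet (hmeet x y) z = hmeet x y <-> hmeet x (himp y z) = x
}.

Inductive hterm :=
| HVar (n : nat) | HBot | HTop
| HJoin (a b : hterm) | HMeet (a b : hterm) | HImp (a b : hterm).

Fixpoint heval (X : HA) (v : nat -> X) (t : hterm) : X :=
  match t with
  | HVar n => v n
  | HBot => hbot X
  | HTop => htop X
  | HJoin a b => hjoin X (heval X v a) (heval X v b)
  | HMeet a b => hmeet X (heval X v a) (heval X v b)
  | HImp a b => himp X (heval X v a) (heval X v b)
  end.

Fixpoint hbnd (n : nat) (t : hterm) : Prop :=
  match t with
  | HVar m => m < n
  | HBot | HTop => True
  | HJoin a b | HMeet a b | HImp a b => hbnd n a /\ hbnd n b
  end.

Definition hhom (X Y : HA) (f : X -> Y) : Prop :=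
  f (hbot X) = hbot Y /\ f (htop X) = htop Y /\
  (forall x y, f (hjoin X x y) = hjoin Y (f x) (f y)) /\
  (forall x y, f (hmeet X x y) = hmeet Y (f x) (f y)) /\
  (forall x y, f (himp X x y) = himp Y (f x) (f y)).

Definition HSig : Sig := @MkSig HA hcar hterm heval hbnd hhom.

Record IA := MkIA {
  icar :> Type;
  i0 : icar; i1 : icar;
  ijoin : icar -> icar -> icar;
  imeet : icar -> icar -> icar;
  icompl : icar -> icar;
  iint : icar -> icar;
  ijoinC : forall x y, ijoin x y = ijoin y x;
  imeetC : forall x y, imeet x y = imeet y x;
  ijoinA : forall x y z, ijoin x (ijoin y z) = ijoin (ijoin x y) z;
  imeetA : forall x y z, imeet x (imeet y z) = imeet (imeet x y) z;
  ijoin_abs : forall x y, ijoin x (imeet x y) = x;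
  imeet_abs : forall x y, imeet x (ijoin x y) = x;
  imeet_distr : forall x y z, imeet x (ijoin y z) = ijoin (imeet x y) (imeet x z);
  ijoin_0 : forall x, ijoin x i0 = x;
  imeet_1 : forall x, imeet x i1 = x;
  ijoin_compl : forall x, ijoin x (icompl x) = i1;
  imeet_compl : forall x, imeet x (icompl x) = i0;
  iint_1 : iint i1 = i1;
  iint_meet : forall x y, iint (imeet x y) = imeet (iint x) (iint y);
  iint_le : forall x, imeet (iint x) x = iint x;
  iint_idem : forall x, iint (iint x) = iint x
}.

Inductive iterm :=
| IVar (n : nat) | I0 | I1
| IJoin (a b : iterm) | IMeet (a b : iterm) | ICompl (a : iterm) | IInt (a : iterm).

Fixpoint ieval (X : IA) (v : nat -> X) (t : iterm) : X :=
  match t with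
  | IVar n => v n
  | I0 => i0 X
  | I1 => i1 X
  | IJoin a b => ijoin X (ieval X v a) (ieval X v b)
  | IMeet a b => imeet X (ieval X v a) (ieval X v b)
  | ICompl a => icompl X (ieval X v a)
  | IInt a => iint X (ieval X v a)
  end.

Fixpoint ibnd (n : nat) (t : iterm) : Prop :=
  match t with
  | IVar m => m < n
  | I0 | I1 => True
  | IJoin a b | IMeet a b => ibnd n a /\ ibnd n b
  | ICompl a | IInt a => ibnd n a
  end.

Fixpoint bool_term (t : iterm) : Prop :=
  match t with
  | IVar _ | I0 | I1 => True
  | IJoin a b | IMeet a b => bool_term a /\ bool_term b
  | ICompl a => bool_term a
  | IInt _ => False
  end.

Definition ihom (X Y : IA) (f : X -> Y) : Prop :=
  f (i0 X) = i0 Y /\ f (i1 X) = i1 Y /\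
  (forall x y, f (ijoin X x y) = ijoin Y (f x) (f y)) /\
  (forall x y, f (imeet X x y) = imeet Y (f x) (f y)) /\
  (forall x, f (icompl X x) = icompl Y (f x)) /\
  (forall x, f (iint X x) = iint Y (f x)).

Definition ISig : Sig := @MkSig IA icar iterm ieval ibnd ihom.

(* B is (a copy of) B(L) = <Fr(L), g_L>: the Boolean reduct of B is a  *)
(* free (minimal) Boolean extension of the bounded lattice L via e     *)
(* (e a bounded-lattice embedding whose image generates B as a Boolean *)
(* algebra), and g((-u1+v1)...(-un+vn)) = (u1=>v1)...(un=>vn).        *)
Definition is_BL (L : HA) (B : IA) : Prop :=
  exists e : L -> B,
    (forall x y, e x = e y -> x = y) /\
    e (hbot L) = i0 B /\ e (htop L) = i1 B /\
    (forall x y, e (hjoin L x y) = ijoin B (e x) (e y)) /\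
    (forall x y, e (hmeet L x y) = imeet B (e x) (e y)) /\
    (forall x : B, exists (t : iterm) (v : nat -> L),
        bool_term t /\ ieval B (fun i => e (v i)) t = x) /\
    (forall l : list (L * L),
       iint B (fold_right (fun p acc =>
                 imeet B (ijoin B (icompl B (e (fst p))) (e (snd p))) acc)
               (i1 B) l)
       = fold_right (fun p acc => imeet B (e (himp L (fst p) (snd p))) acc)
               (i1 B) l).

Definition rho_star (V : HA -> Prop) : IA -> Prop :=
  @gen_variety ISig (fun B => exists L, V L /\ is_BL L B).

(* Main.v *)
Require Import Defs.
From mathcomp Require boolp classical_sets.
From Stdlib Require Import List Setoid Lia.
Import ListNotations.

(** Heyting homomorphisms from P to the open elements of an interior algebra X
    extend uniquely to homomorphisms from B(P) to X, so P |-> B(P) preserves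
    finite presentability and projectivity, and it preserves and reflects the
    order on unifiers. Conversely, let C be the target of a unifier of B(L). It
    is finite by local finiteness, and it satisfies Grzegorczyk's law, because
    every B(P) does. In a finite algebra this law makes every element a Boolean
    combination of open ones, so C is itself B(O(C)) for its Heyting algebra
    O(C) of open elements, and O(C) is finitely presented and projective in V.
    Hence the two quasiorders of unifiers are equivalent. *)

(** * Prime filters of bounded distributive lattices *)

(** Membership in [rho_star V] yields only equations, and being a copy of some B(P) is not stated as
    one. Grzegorczyk's law is an equation, so it survives the passage from the algebras B(L) to the
    variety they generate, and finiteness then turns it back into generation by open elements.
    Translating Heyting equations into interior ones brings O(C) back into V in the same way. Normal
    forms are not unique, so a map defined on them must be shown independent of the form chosen.
    Equations are therefore tested at prime filters, where a normal form becomes a list of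
    implications between elements of L. B(P) is determined only up to isomorphism, hence unifiers
    are matched by a relation and not by a function. *)

Record dlattice := MkDL {
  dcar :> Type;
  d0 : dcar; d1 : dcar;
  dj : dcar -> dcar -> dcar;
  dm : dcar -> dcar -> dcar;
  djC : forall x y, dj x y = dj y x;
  dmC : forall x y, dm x y = dm y x;
  djA : forall x y z, dj x (dj y z) = dj (dj x y) z;
  dmA : forall x y z, dm x (dm y z) = dm (dm x y) z;
  dj_abs : forall x y, dj x (dm x y) = x;
  dm_abs : forall x y, dm x (dj x y) = x;
  dm_distr : forall x y z, dm x (dj y z) = dj (dm x y) (dm x z);
  dj_0 : forall x, dj x d0 = x;
  dm_1 : forall x, dm x d1 = x
}.

Arguments d0 {_}. Arguments d1 {_}. Arguments dj {_}. Arguments dm {_}.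

Definition dle {D : dlattice} (x y : D) : Prop := dm x y = x.

Record prime_filter (D : dlattice) (p : D -> Prop) : Prop := {
  prime1 : p d1;
  prime0 : ~ p d0;
  primeM : forall x y, p (dm x y) <-> p x /\ p y;
  primeJ : forall x y, p (dj x y) <-> p x \/ p y
}.

Lemma dm_idem (D : dlattice) (x : D) : dm x x = x.
Proof. rewrite <- (dj_abs D x x) at 2; apply dm_abs. Qed.

Lemma dle_refl (D : dlattice) (x : D) : dle x x.
Proof. apply dm_idem. Qed.

Lemma dle_trans (D : dlattice) (x y z : D) : dle x y -> dle y z -> dle x z.
Proof. unfold dle; intros H K; rewrite <- H, <- dmA, K; reflexivity. Qed.

Lemma dle_anti (D : dlattice) (x y : D) : dle x y -> dle y x -> x = y.
Proof. unfold dle; intros H K; rewrite <- H, dmC; exact K. Qed.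

Lemma dm_lel (D : dlattice) (x y : D) : dle (dm x y) x.
Proof. unfold dle; rewrite dmC, dmA, dm_idem; reflexivity. Qed.

Lemma dm_ler (D : dlattice) (x y : D) : dle (dm x y) y.
Proof. rewrite dmC; apply dm_lel. Qed.

Lemma dm_glb (D : dlattice) (x y z : D) : dle z x -> dle z y -> dle z (dm x y).
Proof. unfold dle; intros H K; rewrite dmA, H, K; reflexivity. Qed.

Lemma dj_lel (D : dlattice) (x y : D) : dle x (dj x y).
Proof. apply dm_abs. Qed.

Lemma dj_ler (D : dlattice) (x y : D) : dle y (dj x y).
Proof. rewrite djC; apply dj_lel. Qed.

Lemma dj_lub (D : dlattice) (x y z : D) : dle x z -> dle y z -> dle (dj x y) z.
Proof.
  unfold dle; intros H K.
  rewrite dmC, dm_distr, (dmC _ z x), (dmC _ z y), H, K; reflexivity.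
Qed.

Lemma dle_1 (D : dlattice) (x : D) : dle x d1.
Proof. apply dm_1. Qed.

Lemma dle_0 (D : dlattice) (x : D) : dle d0 x.
Proof. rewrite <- (dj_0 D x), djC; apply dj_lel. Qed.

Lemma dm_mono (D : dlattice) (x y z t : D) :
  dle x z -> dle y t -> dle (dm x y) (dm z t).
Proof.
  intros H K; apply dm_glb; eapply dle_trans.
  - apply dm_lel.
  - exact H.
  - apply dm_ler.
  - exact K.
Qed.

Lemma prime_separation (D : dlattice) (A N : D -> Prop) :
  A d1 -> N d0 ->
  (forall x y, A x -> A y -> A (dm x y)) ->
  (forall x y, N x -> N y -> N (dj x y)) ->
  (forall a n, A a -> N n -> ~ dle a n) ->
  exists p, prime_filter D p /\ (forall a, A a -> p a) /\ (forall n, N n -> ~ p n).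
Proof.
  intros A1 N0 AM NJ AN.
  (* Neither [S d1] nor the inclusion of [A] in [S] is required, because the union of the empty
     chain must satisfy [P] as well; both are recovered from maximality. *)
  pose (P := fun S : D -> Prop =>
    (forall x y, S x -> dle x y -> S y) /\
    (forall x y, S x -> S y -> S (dm x y)) /\
    (forall x a n, S x -> A a -> N n -> ~ dle (dm a x) n)).
  destruct (@classical_sets.Zorn_bigcup D P) as [S [[Sup [SM SN]] Smax]].
  { intros F FP Ftot; split; [|split].
    - intros x y [T FT Tx] xy; exists T; auto.
      destruct (FP T FT) as [Tup _]; eauto.
    - intros x y [T FT Tx] [T' FT' Ty].
      destruct (Ftot T T' FT FT') as [TT | TT].
      + exists T'; auto; destruct (FP T' FT') as [_ [TM _]]; auto.
      + exists T; auto; destruct (FP T FT) as [_ [TM _]]; auto.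
    - intros x a n [T FT Tx]; destruct (FP T FT) as [_ [_ TN]]; auto. }
  (* Maximality: [y] belongs to [S] as soon as the filter generated by [S] and [y] keeps the
     separation. The case [x = d1] allows for [S] being still empty. *)
  assert (adj : forall y,
    (forall x a n, S x \/ x = d1 -> A a -> N n -> ~ dle (dm a (dm x y)) n) -> S y).
  { intros y Hy; apply boolp.contrapT; intro nSy.
    apply (Smax (fun t => exists x, (S x \/ x = d1) /\ dle (dm x y) t)).
    - split.
      + intros t St; exists t; split; auto using dm_lel.
      + intro sub; apply nSy, sub; exists d1; split; auto using dm_ler.
    - split; [|split].
      + intros s t [x [Sx xs]] st; exists x; eauto using dle_trans.
      + intros s t [x [Sx xs]] [z [Sz zt]]; exists (dm x z); split.
        * destruct Sx as [Sx | ->]; [destruct Sz as [Sz | ->]|].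
          -- auto.
          -- rewrite dm_1; auto.
          -- rewrite dmC, dm_1; auto.
        * apply dm_glb; eapply dle_trans; [| exact xs | | exact zt];
            apply dm_mono; auto using dle_refl, dm_lel, dm_ler.
      + intros t a n [x [Sx xt]] Aa Nn le; apply (Hy x a n Sx Aa Nn).
        eapply dle_trans; [| exact le]; apply dm_mono; auto using dle_refl. }
  assert (S1 : S d1).
  { apply adj; intros x a n [Sx | ->] Aa Nn; rewrite !dm_1; auto. }
  assert (adj' : forall y, ~ S y -> exists x a n,
    S x /\ A a /\ N n /\ dle (dm a (dm x y)) n).
  { intros y nSy; apply boolp.contrapT; intro H; apply nSy, adj.
    intros x a n Sx Aa Nn le; apply H; exists x, a, n.
    destruct Sx as [Sx | ->]; auto. }
  exists S; split; [split|split]; auto.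
  - intro S0; apply (SN d0 d1 d0); auto; apply dm_ler.
  - intros x y; split; [|intros []; auto].
    intro H; split; apply (Sup _ _ H); auto using dm_lel, dm_ler.
  - intros x y; split.
    2: { intros [H | H]; apply (Sup _ _ H); auto using dj_lel, dj_ler. }
    intro Sxy; apply boolp.contrapT; intro H.
    destruct (adj' x) as [s [a [n [Ss [Aa [Nn le]]]]]]; [tauto|].
    destruct (adj' y) as [t [b [m [St [Ab [Nm le']]]]]]; [tauto|].
    (* By distributivity the obstructions to adjoining [x] and [y] combine into one against
       [dj x y], which lies in [S]. *)
    apply (SN (dm (dm s t) (dj x y)) (dm a b) (dj n m)); auto.
    rewrite dm_distr, dm_distr; apply dj_lub.
    + eapply dle_trans; [| apply dj_lel]; eapply dle_trans; [| exact le].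
      apply dm_mono; [| apply dm_mono]; auto using dle_refl, dm_lel, dm_ler.
    + eapply dle_trans; [| apply dj_ler]; eapply dle_trans; [| exact le'].
      apply dm_mono; [| apply dm_mono]; auto using dle_refl, dm_lel, dm_ler.
  (* As [A] is closed under meets, [a0] is absorbed into the element [a] of [A]. *)
  - intros a0 Aa0; apply adj; intros x a n Sx Aa Nn le.
    assert (Sx' : S x) by (destruct Sx as [Sx | ->]; auto).
    apply (SN x (dm a a0) n); auto; rewrite <- dmA, (dmC _ a0 x); exact le.
  - intros n Nn Sn; apply (SN n d1 n); auto using dm_ler.
Qed.

Lemma prime_separates_points (D : dlattice) (a b : D) :
  (forall p, prime_filter D p -> p a -> p b) -> dle a b.
Proof.
  intro H; apply boolp.contrapT; intro nle.
  destruct (prime_separation D (fun x => dle a x) (fun x => dle x b))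
    as [p [pp [pa pb]]]; eauto using dle_1, dle_0, dm_glb, dj_lub, dle_trans.
  apply (pb b); [| apply H, pa]; auto using dle_refl.
Qed.

Lemma prime_ext (D : dlattice) (a b : D) :
  (forall p, prime_filter D p -> (p a <-> p b)) -> a = b.
Proof.
  intro H; apply dle_anti; apply prime_separates_points; intros p pp;
    apply (H p pp).
Qed.

Definition IA_dlattice (X : IA) : dlattice :=
  MkDL X (i0 X) (i1 X) (ijoin X) (imeet X) (ijoinC X) (imeetC X) (ijoinA X)
    (imeetA X) (ijoin_abs X) (imeet_abs X) (imeet_distr X) (ijoin_0 X) (imeet_1 X).

Lemma prime_compl (X : IA) (p : X -> Prop) (x : X) :
  prime_filter (IA_dlattice X) p -> (p (icompl X x) <-> ~ p x).
Proof.
  intros [p1 p0 pm pj]; cbn in *; split.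
  - intros pc px; apply p0; rewrite <- (imeet_compl X x), pm; auto.
  - intro npx; rewrite <- (ijoin_compl X x), pj in p1; tauto.
Qed.

(** Distributivity comes from residuation: meeting with x is a left adjoint, so it preserves
    joins. *)
Lemma HA_distr (L : HA) (x y z : L) :
  hmeet L x (hjoin L y z) = hjoin L (hmeet L x y) (hmeet L x z).
Proof.
  assert (idem : forall a, hmeet L a a = a).
  { intro a; rewrite <- (hjoin_abs L a a) at 2; apply hmeet_abs. }
  assert (lub : forall a b c, hmeet L a c = a -> hmeet L b c = b ->
            hmeet L (hjoin L a b) c = hjoin L a b).
  { intros a b c Ha Hb.
    assert (Ec : hjoin L c (hjoin L a b) = c).
    { rewrite hjoinA, <- Ha, (hmeetC L a c), hjoin_abs.
      rewrite <- Hb, (hmeetC L b c); apply hjoin_abs. }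
    rewrite <- Ec, hmeetC, (hjoinC L c), hmeetC; apply hmeet_abs. }
  assert (gel : forall a b, hmeet L a (hjoin L a b) = a) by apply hmeet_abs.
  assert (ger : forall a b, hmeet L b (hjoin L a b) = b).
  { intros a b; rewrite hjoinC; apply hmeet_abs. }
  assert (anti : forall a b, hmeet L a b = a -> hmeet L b a = b -> a = b).
  { intros a b H K; rewrite <- H, hmeetC; exact K. }
  assert (tr : forall a b c, hmeet L a b = a -> hmeet L b c = b -> hmeet L a c = a).
  { intros a b c H K; rewrite <- H, <- hmeetA, K; reflexivity. }
  apply anti.
  - rewrite (hmeetC L x (hjoin L y z)).
    apply himp_adj, lub; apply himp_adj; rewrite (hmeetC L _ x); auto.
  - apply lub.
    + rewrite <- hmeetA, (hmeetA L y), (hmeetC L y x), <- (hmeetA L x), gel.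
      rewrite hmeetA, idem; reflexivity.
    + rewrite <- hmeetA, (hmeetA L z), (hmeetC L z x), <- (hmeetA L x), ger.
      rewrite hmeetA, idem; reflexivity.
Qed.

Definition HA_dlattice (L : HA) : dlattice :=
  MkDL L (hbot L) (htop L) (hjoin L) (hmeet L) (hjoinC L) (hmeetC L) (hjoinA L)
    (hmeetA L) (hjoin_abs L) (hmeet_abs L) (HA_distr L) (hjoin_bot L) (hmeet_top L).

Ltac prime_cases p :=
  repeat match goal with
  | H : context [p ?x] |- _ =>
      lazymatch goal with
      | _ : p x |- _ => fail
      | _ : ~ p x |- _ => fail
      | _ => destruct (boolp.EM (p x))
      end
  | |- context [p ?x] =>
      lazymatch goal with
      | _ : p x |- _ => fail
      | _ : ~ p x |- _ => fail
      | _ => destruct (boolp.EM (p x))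
      end
  end.

Ltac prime_simpl X p Hp :=
  let E1 := fresh in let E0 := fresh in let EM := fresh in
  let EJ := fresh in let EC := fresh in
  pose proof (prime1 _ _ Hp) as E1; pose proof (prime0 _ _ Hp) as E0;
  pose proof (primeM _ _ Hp) as EM; pose proof (primeJ _ _ Hp) as EJ;
  pose proof (fun x => prime_compl X p x Hp) as EC; cbn in E1, E0, EM, EJ;
  repeat match goal with
  | H : @eq (icar X) ?a ?b |- _ =>
      let H' := fresh in
      assert (H' : p a <-> p b) by (rewrite H; reflexivity);
      clear H; repeat (rewrite ?EM, ?EJ, ?EC in H')
  end;
  repeat (rewrite ?EM, ?EJ, ?EC); clear EM EJ EC.

(* Decides an equation of Boolean algebras from the equations in the context,
   by evaluating both sides at an arbitrary prime filter. *)
Ltac boolean X :=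
  apply (prime_ext (IA_dlattice X));
  let p := fresh "p" in let Hp := fresh "Hp" in intros p Hp;
  prime_simpl X p Hp; clear Hp; prime_cases p; tauto.

(** * Minimal Boolean extensions *)

Lemma iint_mono (X : IA) (x y : X) :
  imeet X x y = x -> imeet X (iint X x) (iint X y) = iint X x.
Proof. intro H; rewrite <- iint_meet, H; reflexivity. Qed.

Lemma iint_glb (X : IA) (w x : X) :
  iint X w = w -> imeet X w x = w -> imeet X w (iint X x) = w.
Proof. intros Hw H; apply iint_mono in H; rewrite Hw in H; exact H. Qed.

Lemma iint_0 (X : IA) : iint X (i0 X) = i0 X.
Proof. pose proof (iint_le X (i0 X)); boolean X. Qed.

Lemma iint_join (X : IA) (x y : X) :
  iint X x = x -> iint X y = y -> iint X (ijoin X x y) = ijoin X x y.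
Proof.
  intros Hx Hy; pose proof (iint_le X (ijoin X x y)).
  assert (imeet X x (iint X (ijoin X x y)) = x)
    by (apply iint_glb; [assumption | clear; boolean X]).
  assert (imeet X y (iint X (ijoin X x y)) = y)
    by (apply iint_glb; [assumption | clear; boolean X]).
  clear Hx Hy; boolean X.
Qed.

(** The map [f] is a parameter so that one list can be evaluated both in B(L) and in the target of a
    homomorphism to be extended. *)
Definition cnf {L : Type} {X : IA} (f : L -> X) (l : list (L * L)) : X :=
  fold_right (fun p acc =>
    imeet X (ijoin X (icompl X (f (fst p))) (f (snd p))) acc) (i1 X) l.

Arguments cnf : simpl never.

Lemma cnf_nil (L : Type) (X : IA) (f : L -> X) : cnf f [] = i1 X.
Proof. reflexivity. Qed.

Lemma cnf_cons (L : Type) (X : IA) (f : L -> X) (u v : L) (l : list (L * L)) :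
  cnf f ((u, v) :: l) = imeet X (ijoin X (icompl X (f u)) (f v)) (cnf f l).
Proof. reflexivity. Qed.

Definition in_cnf {L : Type} {X : IA} (f : L -> X) (x : X) : Prop :=
  exists l, cnf f l = x.

(* Equivalently, a Heyting homomorphism from L to the open elements of X. *)
Record open_hom (L : HA) (X : IA) (f : L -> X) : Prop := {
  oh0 : f (hbot L) = i0 X;
  oh1 : f (htop L) = i1 X;
  ohJ : forall x y, f (hjoin L x y) = ijoin X (f x) (f y);
  ohM : forall x y, f (hmeet L x y) = imeet X (f x) (f y);
  ohI : forall x y, f (himp L x y) = iint X (ijoin X (icompl X (f x)) (f y))
}.
Arguments oh0 {_ _ _}. Arguments oh1 {_ _ _}. Arguments ohJ {_ _ _}.
Arguments ohM {_ _ _}. Arguments ohI {_ _ _}.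

(** A working form of [is_BL]: normal forms replace Boolean terms, and the interior formula is kept
    for a single clause only ([ohI]), since interior commutes with meets. *)
Record BL_embedding (L : HA) (B : IA) (e : L -> B) : Prop := {
  ble_hom : open_hom L B e;
  ble_inj : forall x y, e x = e y -> x = y;
  ble_cnf : forall x, in_cnf e x
}.
Arguments ble_hom {_ _ _}. Arguments ble_inj {_ _ _}. Arguments ble_cnf {_ _ _}.

Lemma himp_top (L : HA) (u : L) : himp L (htop L) u = u.
Proof.
  apply (dle_anti (HA_dlattice L)); unfold dle; cbn.
  - set (w := himp L (htop L) u).
    rewrite <- (hmeet_top L w) at 1 2; apply himp_adj.
    apply (dle_refl (HA_dlattice L)).
  - apply himp_adj; rewrite hmeet_top; apply (dle_refl (HA_dlattice L)).
Qed.

(** Writing u as 1 ⇒ u makes its image an interior. *)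
Lemma open_hom_open (L : HA) (X : IA) (f : L -> X) (u : L) :
  open_hom L X f -> iint X (f u) = f u.
Proof.
  intro Hf; rewrite <- (himp_top L u), (ohI Hf); apply iint_idem.
Qed.

Lemma in_cnf_meet (L : Type) (X : IA) (f : L -> X) (x y : X) :
  in_cnf f x -> in_cnf f y -> in_cnf f (imeet X x y).
Proof.
  intros [l <-] [l' <-]; exists (l ++ l').
  induction l as [|[u v] l IH]; cbn [app]; rewrite ?cnf_nil, ?cnf_cons.
  - boolean X.
  - rewrite IH; apply imeetA.
Qed.

Lemma in_cnf_clause (L : Type) (X : IA) (f : L -> X) (u v : L) :
  in_cnf f (ijoin X (icompl X (f u)) (f v)).
Proof. exists [(u, v)]; apply imeet_1. Qed.

Lemma in_cnf_gen (L : HA) (X : IA) (f : L -> X) (u : L) :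
  open_hom L X f -> in_cnf f (f u).
Proof.
  intro Hf; destruct (in_cnf_clause L X f (htop L) u) as [l Hl]; exists l.
  rewrite Hl, (oh1 Hf); clear; boolean X.
Qed.

Lemma in_cnf_join (L : HA) (X : IA) (f : L -> X) (x y : X) :
  open_hom L X f -> in_cnf f x -> in_cnf f y -> in_cnf f (ijoin X x y).
Proof.
  intros Hf [l <-] Hy; induction l as [|[u v] l IH]; rewrite ?cnf_nil, ?cnf_cons.
  - exists []; rewrite cnf_nil; clear; boolean X.
  - replace (ijoin X (imeet X (ijoin X (icompl X (f u)) (f v)) (cnf f l)) y)
      with (imeet X (ijoin X (ijoin X (icompl X (f u)) (f v)) y)
              (ijoin X (cnf f l) y)) by (clear; boolean X).
    apply in_cnf_meet; [clear IH l | exact IH].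
    destruct Hy as [l <-]; induction l as [|[u' v'] l IH]; rewrite ?cnf_nil, ?cnf_cons.
    + exists []; rewrite cnf_nil; clear; boolean X.
    (* The join of two clauses is again a clause: antecedents are met and consequents joined inside
       L. *)
    + replace (ijoin X (ijoin X (icompl X (f u)) (f v))
                 (imeet X (ijoin X (icompl X (f u')) (f v')) (cnf f l)))
        with (imeet X (ijoin X (icompl X (f (hmeet L u u'))) (f (hjoin L v v')))
                (ijoin X (ijoin X (icompl X (f u)) (f v)) (cnf f l)))
        by (rewrite (ohM Hf), (ohJ Hf); clear; boolean X).
      apply in_cnf_meet; [apply in_cnf_clause | exact IH].
Qed.

Lemma in_cnf_compl (L : HA) (X : IA) (f : L -> X) (x : X) :
  open_hom L X f -> in_cnf f x -> in_cnf f (icompl X x).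
Proof.
  intros Hf [l <-]; induction l as [|[u v] l IH]; rewrite ?cnf_nil, ?cnf_cons.
  - destruct (in_cnf_gen L X f (hbot L) Hf) as [l Hl]; exists l.
    rewrite Hl, (oh0 Hf); clear; boolean X.
  (* The complement of -u+v is u(-v+0), which has normal form. *)
  - replace (icompl X (imeet X (ijoin X (icompl X (f u)) (f v)) (cnf f l)))
      with (ijoin X (imeet X (f u) (ijoin X (icompl X (f v)) (f (hbot L))))
              (icompl X (cnf f l))) by (rewrite (oh0 Hf); clear; boolean X).
    apply in_cnf_join; auto; apply in_cnf_meet;
      [apply in_cnf_gen; auto | apply in_cnf_clause].
Qed.

Lemma iint_cnf (L : HA) (X : IA) (f : L -> X) (l : list (L * L)) :
  open_hom L X f ->
  iint X (cnf f l)
  = fold_right (fun p acc => imeet X (f (himp L (fst p) (snd p))) acc) (i1 X) l.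
Proof.
  intro Hf; induction l as [|[u v] l IH]; rewrite ?cnf_nil, ?cnf_cons.
  - apply iint_1.
  - rewrite iint_meet, IH; cbn; rewrite (ohI Hf); reflexivity.
Qed.

(** This is why the open elements of B(L) are exactly the images of elements of L. *)
Lemma iint_cnf_open (L : HA) (X : IA) (f : L -> X) (x : X) :
  open_hom L X f -> in_cnf f x -> exists w, iint X x = f w.
Proof.
  intros Hf [l <-]; rewrite iint_cnf by exact Hf.
  exists (fold_right (fun p acc => hmeet L (himp L (fst p) (snd p)) acc) (htop L) l).
  induction l as [|[u v] l IH]; cbn.
  - symmetry; apply (oh1 Hf).
  - rewrite IH, (ohM Hf); reflexivity.
Qed.

Lemma is_BL_embedding (L : HA) (B : IA) :
  is_BL L B -> exists e, BL_embedding L B e.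
Proof.
  intros [e [inj [e0 [e1 [eJ [eM [gen int]]]]]]]; exists e.
  assert (He : open_hom L B e).
  { split; auto; intros u v; specialize (int [(u, v)]); cbn in int.
    rewrite !imeet_1 in int; auto. }
  split; auto; intro x; destruct (gen x) as [t [v [Ht <-]]]; clear gen.
  induction t; cbn in *; try tauto.
  - apply in_cnf_gen; auto.
  - rewrite <- e0; apply in_cnf_gen; auto.
  - rewrite <- e1; apply in_cnf_gen; auto.
  - apply in_cnf_join; tauto.
  - apply in_cnf_meet; tauto.
  - apply in_cnf_compl; tauto.
Qed.

(** Frees the first variables for a new clause placed in front of a term already built. *)
Fixpoint ishift (k : nat) (t : iterm) : iterm :=
  match t with
  | IVar n => IVar (k + n)
  | I0 => I0
  | I1 => I1
  | IJoin a b => IJoin (ishift k a) (ishift k b)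
  | IMeet a b => IMeet (ishift k a) (ishift k b)
  | ICompl a => ICompl (ishift k a)
  | IInt a => IInt (ishift k a)
  end.

Lemma ieval_ishift (X : IA) (v : nat -> X) (k : nat) (t : iterm) :
  ieval X v (ishift k t) = ieval X (fun i => v (k + i)) t.
Proof. induction t; cbn; congruence. Qed.

Lemma bool_term_ishift (k : nat) (t : iterm) : bool_term t -> bool_term (ishift k t).
Proof. induction t; cbn; tauto. Qed.

Lemma embedding_is_BL (L : HA) (B : IA) (e : L -> B) :
  BL_embedding L B e -> is_BL L B.
Proof.
  intros [He inj gen]; exists e; repeat split; auto; try apply He.
  - intro x; destruct (gen x) as [l <-]; clear gen; induction l as [|[a b] l IH].
    + exists I1, (fun _ => htop L); split; cbn; auto using cnf_nil.
    + destruct IH as [t [v [Ht E]]].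
      exists (IMeet (IJoin (ICompl (IVar 0)) (IVar 1)) (ishift 2 t)),
        (fun i => match i with 0 => a | 1 => b | S (S i) => v i end); split.
      * cbn; auto using bool_term_ishift.
      * cbn; rewrite ieval_ishift; cbn; rewrite E, cnf_cons; reflexivity.
  - intro l; apply iint_cnf; exact He.
Qed.

(** * Extension of homomorphisms from L to B(L) *)

Lemma open_hom_prime (L : HA) (X : IA) (f : L -> X) (p : X -> Prop) :
  open_hom L X f -> prime_filter (IA_dlattice X) p ->
  prime_filter (HA_dlattice L) (fun u => p (f u)).
Proof.
  intros Hf [p1 p0 pm pj]; split; cbn in *.
  - rewrite (oh1 Hf); auto.
  - rewrite (oh0 Hf); auto.
  - intros; rewrite (ohM Hf); auto.
  - intros; rewrite (ohJ Hf); auto.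
Qed.

(** The images of q and of its complement can be separated in B: if e u ≤ e v, injectivity gives u ≤
    v, so v is in q whenever u is. *)
Lemma prime_extend (L : HA) (B : IA) (e : L -> B) (q : L -> Prop) :
  BL_embedding L B e -> prime_filter (HA_dlattice L) q ->
  exists r, prime_filter (IA_dlattice B) r /\ forall u, r (e u) <-> q u.
Proof.
  intros He [q1 q0 qm qj]; cbn in *; pose proof (ble_hom He) as Hh.
  destruct (prime_separation (IA_dlattice B) (fun x => exists u, q u /\ x = e u)
    (fun x => exists u, ~ q u /\ x = e u)) as [r [rp [rA rN]]]; cbn.
  - exists (htop L); rewrite (oh1 Hh); auto.
  - exists (hbot L); rewrite (oh0 Hh); auto.
  - intros x y [u [qu ->]] [v [qv ->]]; exists (hmeet L u v).
    rewrite (ohM Hh), qm; auto.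
  - intros x y [u [qu ->]] [v [qv ->]]; exists (hjoin L u v).
    rewrite (ohJ Hh), qj; split; tauto.
  - intros x y [u [qu ->]] [v [qv ->]] le; unfold dle in le; cbn in le.
    rewrite <- (ohM Hh) in le; apply (ble_inj He) in le.
    apply qv; rewrite <- le, qm in qu; tauto.
  - exists r; split; auto; intro u; split; intro H.
    + apply boolp.contrapT; intro K; apply (rN (e u)); eauto.
    + apply rA; eauto.
Qed.

(** Only the trace of p on the image of f matters, so prime filters of different algebras with the
    same trace on L contain the same normal forms. *)
Lemma prime_cnf (L : Type) (X : IA) (f : L -> X) (p : X -> Prop) (l : list (L * L)) :
  prime_filter (IA_dlattice X) p ->
  (p (cnf f l) <-> forall c, In c l -> p (f (fst c)) -> p (f (snd c))).
Proof.
  intro Hp; induction l as [|c l IH].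
  - rewrite cnf_nil; split; [intros _ c [] | intros _; apply (prime1 _ _ Hp)].
  - destruct c as [u v]; rewrite cnf_cons.
    rewrite (primeM _ _ Hp : forall x y, p (imeet X x y) <-> _), IH.
    rewrite (primeJ _ _ Hp : forall x y, p (ijoin X x y) <-> _), prime_compl by exact Hp.
    split.
    + intros [H K] d [<- | Hd]; cbn; [tauto | auto].
    + intro H; split.
      * destruct (boolp.EM (p (f u))); auto.
        right; apply (H (u, v)); cbn; auto.
      * intros d Hd; apply H; right; auto.
Qed.

Lemma BL_extend (L : HA) (B X : IA) (e : L -> B) (f : L -> X) :
  BL_embedding L B e -> open_hom L X f ->
  exists F, ihom B X F /\ forall u, F (e u) = f u.
Proof.
  intros He Hf; pose proof (ble_hom He) as Hh.
  destruct (boolp.choice (ble_cnf He)) as [c Hc].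
  (* Pull [p] back to L along [f], then lift the result to a prime filter [r] of B. Lists that agree
     in B thus agree in X, so re-evaluating any chosen normal form under [f] defines the
     extension. *)
  assert (key : forall p, prime_filter (IA_dlattice X) p ->
    exists r, prime_filter (IA_dlattice B) r /\ (forall u, r (e u) <-> p (f u)) /\
      forall l, r (cnf e l) <-> p (cnf f l)).
  { intros p Hp.
    destruct (prime_extend L B e _ He (open_hom_prime L X f p Hf Hp)) as [r [Hr Er]].
    exists r; split; [|split]; auto; intro l; rewrite !prime_cnf by assumption.
    split; intros H d Hd; specialize (H d Hd); rewrite !Er in *; auto. }
  assert (wd : forall l, cnf f (c (cnf e l)) = cnf f l).
  { intro l; apply (prime_ext (IA_dlattice X)); intros p Hp.
    destruct (key p Hp) as [r [_ [_ Hr]]].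
    rewrite <- (Hr (c (cnf e l))), <- (Hr l), Hc; reflexivity. }
  exists (fun x => cnf f (c x)).
  assert (pt : forall p, prime_filter (IA_dlattice X) p ->
    exists r, prime_filter (IA_dlattice B) r /\ (forall u, r (e u) <-> p (f u)) /\
      forall x, p (cnf f (c x)) <-> r x).
  { intros p Hp; destruct (key p Hp) as [r [Hr [Er Kr]]]; exists r.
    split; [|split]; auto; intro x; rewrite <- Kr, Hc; reflexivity. }
  split.
  2: { intro u; apply (prime_ext (IA_dlattice X)); intros p Hp.
       destruct (pt p Hp) as [r [Hr [Er Kr]]]; rewrite Kr; apply Er. }
  repeat split.
  - apply (prime_ext (IA_dlattice X)); intros p Hp.
    destruct (pt p Hp) as [r [Hr [Er Kr]]]; rewrite Kr.
    pose proof (prime0 _ _ Hp); pose proof (prime0 _ _ Hr); cbn in *; tauto.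
  - apply (prime_ext (IA_dlattice X)); intros p Hp.
    destruct (pt p Hp) as [r [Hr [Er Kr]]]; rewrite Kr.
    pose proof (prime1 _ _ Hp); pose proof (prime1 _ _ Hr); cbn in *; tauto.
  - intros x y; apply (prime_ext (IA_dlattice X)); intros p Hp.
    destruct (pt p Hp) as [r [Hr [Er Kr]]].
    pose proof (primeJ _ _ Hp) as Jp; pose proof (primeJ _ _ Hr) as Jr; cbn in *.
    rewrite Jp, !Kr; apply Jr.
  - intros x y; apply (prime_ext (IA_dlattice X)); intros p Hp.
    destruct (pt p Hp) as [r [Hr [Er Kr]]].
    pose proof (primeM _ _ Hp) as Mp; pose proof (primeM _ _ Hr) as Mr; cbn in *.
    rewrite Mp, !Kr; apply Mr.
  - intros x; apply (prime_ext (IA_dlattice X)); intros p Hp.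
    destruct (pt p Hp) as [r [Hr [Er Kr]]].
    rewrite (prime_compl X p _ Hp), !Kr; apply (prime_compl B r _ Hr).
  - intro x; destruct (ble_cnf He x) as [l <-]; rewrite wd.
    rewrite (iint_cnf L X f l Hf), (iint_cnf L B e l Hh).
    (* Each factor u ⇒ v of the interior is the clause with antecedent 1, so both interiors are
       normal forms of one common list and [wd] applies. *)
    assert (E : exists l', fold_right
      (fun p acc => imeet B (e (himp L (fst p) (snd p))) acc) (i1 B) l = cnf e l' /\
      fold_right (fun p acc => imeet X (f (himp L (fst p) (snd p))) acc) (i1 X) l
      = cnf f l').
    { exists (map (fun p => (htop L, himp L (fst p) (snd p))) l).
      clear - Hf Hh; induction l as [|[u v] l [IH IH']]; cbn; [auto|].
      rewrite !cnf_cons, IH, IH', (oh1 Hf), (oh1 Hh); clear; split; [boolean B | boolean X]. }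
    destruct E as [l' [-> ->]]; apply wd.
Qed.

Lemma ihom_cnf (L : Type) (B X : IA) (e : L -> B) (h : B -> X) (l : list (L * L)) :
  ihom B X h -> h (cnf e l) = cnf (fun u => h (e u)) l.
Proof.
  intros [h0 [h1 [hJ [hM [hC hI]]]]]; induction l as [|[u v] l IH]; [exact h1|].
  rewrite !cnf_cons, hM, hJ, hC, IH; reflexivity.
Qed.

Lemma BL_ihom_ext (L : HA) (B X : IA) (e : L -> B) (h k : B -> X) :
  BL_embedding L B e -> ihom B X h -> ihom B X k ->
  (forall u, h (e u) = k (e u)) -> forall x, h x = k x.
Proof.
  intros He Hh Hk E x; destruct (ble_cnf He x) as [l <-].
  rewrite !ihom_cnf by assumption; f_equal; apply boolp.funext; exact E.
Qed.

Lemma open_hom_comp (L : HA) (X Y : IA) (f : L -> X) (h : X -> Y) :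
  open_hom L X f -> ihom X Y h -> open_hom L Y (fun u => h (f u)).
Proof.
  intros Hf [h0 [h1 [hJ [hM [hC hI]]]]]; split; intros.
  - rewrite (oh0 Hf); auto.
  - rewrite (oh1 Hf); auto.
  - rewrite (ohJ Hf); auto.
  - rewrite (ohM Hf); auto.
  - rewrite (ohI Hf), hI, hJ, hC; auto.
Qed.

Lemma hhom_open_comp (L M : HA) (X : IA) (f : L -> M) (h : M -> X) :
  hhom L M f -> open_hom M X h -> open_hom L X (fun u => h (f u)).
Proof.
  intros [f0 [f1 [fJ [fM fI]]]] Hh; split; intros.
  - rewrite f0; apply Hh.
  - rewrite f1; apply Hh.
  - rewrite fJ; apply Hh.
  - rewrite fM; apply Hh.
  - rewrite fI; apply Hh.
Qed.

(** The values of f are open, hence lie in the image of e, and injectivity of e makes the factor a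
    homomorphism. *)
Lemma BL_lift_open (L M : HA) (B : IA) (e : M -> B) (f : L -> B) :
  BL_embedding M B e -> open_hom L B f ->
  exists g, hhom L M g /\ forall u, e (g u) = f u.
Proof.
  intros He Hf; pose proof (ble_hom He) as Hh.
  assert (E : forall u, exists w, e w = f u).
  { intro u; destruct (iint_cnf_open M B e (f u) Hh (ble_cnf He _)) as [w Hw].
    exists w; rewrite <- Hw; eapply open_hom_open; eauto. }
  destruct (boolp.choice E) as [g Hg]; exists g; split; auto.
  repeat split; intros; apply (ble_inj He).
  - rewrite Hg, (oh0 Hf), (oh0 Hh); auto.
  - rewrite Hg, (oh1 Hf), (oh1 Hh); auto.
  - rewrite (ohJ Hh), !Hg; apply Hf.
  - rewrite (ohM Hh), !Hg; apply Hf.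
  - rewrite (ohI Hh), !Hg; apply Hf.
Qed.

(** * Existence of B(L), inside the power set of the prime spectrum *)

Lemma proj1_sig_inj (T : Type) (P : T -> Prop) (x y : {x | P x}) :
  proj1_sig x = proj1_sig y -> x = y.
Proof. destruct x, y; cbn; apply boolp.eq_exist. Qed.

Definition sub_IA (X : IA) (Q : X -> Prop) (Q0 : Q (i0 X)) (Q1 : Q (i1 X))
  (QJ : forall x y, Q x -> Q y -> Q (ijoin X x y))
  (QM : forall x y, Q x -> Q y -> Q (imeet X x y))
  (QC : forall x, Q x -> Q (icompl X x)) (QI : forall x, Q x -> Q (iint X x)) : IA.
Proof.
  refine (@MkIA {x | Q x} (exist Q _ Q0) (exist Q _ Q1)
    (fun x y => exist Q _ (QJ _ _ (proj2_sig x) (proj2_sig y)))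
    (fun x y => exist Q _ (QM _ _ (proj2_sig x) (proj2_sig y)))
    (fun x => exist Q _ (QC _ (proj2_sig x)))
    (fun x => exist Q _ (QI _ (proj2_sig x))) _ _ _ _ _ _ _ _ _ _ _ _ _ _ _);
    intros; apply proj1_sig_inj; cbn; apply X.
Defined.

Definition spectrum (L : HA) : Type := {p : L -> Prop | prime_filter (HA_dlattice L) p}.

(* The interior for the topology whose basic open sets are the
   [fun p => proj1_sig p w], for w in L. *)
Definition spec_int (L : HA) (S : spectrum L -> Prop) (p : spectrum L) : Prop :=
  exists w, proj1_sig p w /\ forall q, proj1_sig q w -> S q.

Definition spectrum_IA (L : HA) : IA.
Proof.
  refine (@MkIA (spectrum L -> Prop) (fun _ => False) (fun _ => True)
    (fun S T p => S p \/ T p) (fun S T p => S p /\ T p) (fun S p => ~ S p)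
    (spec_int L) _ _ _ _ _ _ _ _ _ _ _ _ _ _ _);
    intros; apply boolp.funext; intro p; apply boolp.propext; try tauto.
  - pose proof (boolp.EM (x p)); tauto.
  - split; auto; intros _; exists (htop L); split; auto.
    apply (prime1 _ _ (proj2_sig p)).
  - split.
    + intros [w [pw H]]; split; exists w; split; auto; intros q qw; apply (H q qw).
    + intros [[w [pw H]] [w' [pw' H']]]; exists (hmeet L w w'); split.
      * apply (primeM _ _ (proj2_sig p)); auto.
      * intros q qw; apply (primeM _ _ (proj2_sig q)) in qw.
        destruct qw; auto.
  - split; [tauto|]; intros [w [pw H]]; split; auto; exists w; auto.
  - split; intros [w [pw H]]; exists w; split; auto.
    + intros q qw; destruct (H q qw) as [w' [qw' H']]; auto.
    + intros q qw; exists w; auto.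
Defined.

Definition spec_emb (L : HA) (u : L) : spectrum_IA L := fun p => proj1_sig p u.

Lemma spec_emb_le (L : HA) (u v : L) :
  (forall p, spec_emb L u p -> spec_emb L v p) -> hmeet L u v = u.
Proof.
  intro H; apply (prime_separates_points (HA_dlattice L)).
  intros p Hp; apply (H (exist _ p Hp)).
Qed.

(** Only implication involves the topology: the basic open set of w lies in -x+y iff wx ≤ y, by
    prime separation, that is, iff w ≤ x ⇒ y. *)
Lemma spec_emb_open_hom (L : HA) : open_hom L (spectrum_IA L) (spec_emb L).
Proof.
  split; intros; apply boolp.funext; intro p; apply boolp.propext; cbn.
  - pose proof (prime0 _ _ (proj2_sig p)); cbn in *; unfold spec_emb; tauto.
  - pose proof (prime1 _ _ (proj2_sig p)); cbn in *; unfold spec_emb; tauto.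
  - apply (primeJ _ _ (proj2_sig p)).
  - apply (primeM _ _ (proj2_sig p)).
  - split.
    + intro H; exists (himp L x y); split; auto; intros q qw.
      destruct (boolp.EM (spec_emb L x q)) as [qx | nqx]; auto; right.
      assert (E : hmeet L (hmeet L (himp L x y) x) y = hmeet L (himp L x y) x)
        by apply himp_adj, (dle_refl (HA_dlattice L)).
      pose proof (primeM _ _ (proj2_sig q)) as qm; cbn in qm.
      assert (K : proj1_sig q (hmeet L (himp L x y) x)) by (apply qm; auto).
      rewrite <- E in K; apply qm in K; apply K.
    + intros [w [pw H]].
      assert (E : hmeet L w (himp L x y) = w).
      { apply himp_adj, spec_emb_le; intros q qm.
        apply (primeM _ _ (proj2_sig q)) in qm; destruct qm as [qw qx].
        destruct (H q qw) as [nqx | qy]; [destruct (nqx qx) | exact qy]. }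
      rewrite <- E in pw; apply (primeM _ _ (proj2_sig p)) in pw; apply pw.
Qed.

(** The Boolean combinations of basic open sets are closed under interior by [iint_cnf_open], so
    they form a subalgebra of [spectrum_IA L]. *)
Lemma BL_exists (L : HA) : exists B e, BL_embedding L B e.
Proof.
  pose (X := spectrum_IA L); pose (e := spec_emb L : L -> X).
  assert (He : open_hom L X e) by apply spec_emb_open_hom.
  assert (Q0 : in_cnf e (i0 X)) by (rewrite <- (oh0 He); apply in_cnf_gen, He).
  assert (Q1 : in_cnf e (i1 X)) by (rewrite <- (oh1 He); apply in_cnf_gen, He).
  assert (QI : forall x, in_cnf e x -> in_cnf e (iint X x)).
  { intros x Hx; destruct (iint_cnf_open L X e x He Hx) as [w ->].
    apply in_cnf_gen, He. }
  exists (sub_IA X (in_cnf e) Q0 Q1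
    (fun x y => in_cnf_join L X e x y He) (in_cnf_meet L X e)
    (fun x => in_cnf_compl L X e x He) QI),
    (fun u => exist _ (e u) (in_cnf_gen L X e u He)).
  split.
  - split; intros; apply proj1_sig_inj; cbn; apply He.
  - intros u v E; apply (f_equal (@proj1_sig _ _)) in E; cbn in E.
    apply (dle_anti (HA_dlattice L)); apply spec_emb_le; intro p;
      unfold e in E; rewrite E; auto.
  - intros [x [l E]]; exists l; apply proj1_sig_inj; cbn; rewrite <- E; clear.
    induction l as [|[u v] l IH]; [reflexivity|].
    rewrite !cnf_cons, <- IH; reflexivity.
Qed.

(** * The Heyting algebra of open elements *)

Definition opens (X : IA) : HA.
Proof.
  pose (Q := fun x => iint X x = x).
  assert (QM : forall x y, Q x -> Q y -> Q (imeet X x y)).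
  { intros x y Hx Hy; unfold Q; rewrite iint_meet, Hx, Hy; reflexivity. }
  refine (@MkHA {x | Q x} (exist Q _ (iint_0 X)) (exist Q _ (iint_1 X))
    (fun x y => exist Q _ (iint_join X _ _ (proj2_sig x) (proj2_sig y)))
    (fun x y => exist Q _ (QM _ _ (proj2_sig x) (proj2_sig y)))
    (fun x y => exist Q _
      (iint_idem X (ijoin X (icompl X (proj1_sig x)) (proj1_sig y))))
    _ _ _ _ _ _ _ _ _);
    intros; try (apply proj1_sig_inj; cbn; apply X).
  destruct x as [x Hx], y as [y Hy], z as [z Hz].
  split; intro E; apply (f_equal (@proj1_sig _ _)) in E; cbn in E;
    apply proj1_sig_inj; cbn.
  - apply iint_glb; auto; clear - E; boolean X.
  - pose proof (iint_le X (ijoin X (icompl X y) z)); clear - E H; boolean X.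
Defined.

Definition open_val (X : IA) : opens X -> X := @proj1_sig _ _.

Lemma open_val_inj (X : IA) (x y : opens X) : open_val X x = open_val X y -> x = y.
Proof. apply proj1_sig_inj. Qed.

Lemma open_val_hom (X : IA) : open_hom (opens X) X (open_val X).
Proof. split; reflexivity. Qed.

Definition open_of (X : IA) (x : X) : opens X := 
  exist (fun y => iint X y = y) (iint X x) (iint_idem X x).

Lemma open_of_val (X : IA) (x : X) : open_val X (open_of X x) = iint X x.
Proof. reflexivity. Qed.

Lemma opens_lift (L : HA) (X : IA) (f : L -> X) :
  open_hom L X f -> exists g, hhom L (opens X) g /\ forall u, open_val X (g u) = f u.
Proof.
  intro Hf; exists (fun u => exist (fun x => iint X x = x) (f u) (open_hom_open L X f u Hf)).
  split; [| reflexivity].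
  repeat split; intros; apply open_val_inj; cbn; apply Hf.
Qed.

(** The Gödel-McKinsey-Tarski translation. Variables are boxed so that every valuation in an
    interior algebra acts through open elements. *)
Fixpoint godel (t : hterm) : iterm :=
  match t with
  | HVar n => IInt (IVar n)
  | HBot => I0
  | HTop => I1
  | HJoin a b => IJoin (godel a) (godel b)
  | HMeet a b => IMeet (godel a) (godel b)
  | HImp a b => IInt (IJoin (ICompl (godel a)) (godel b))
  end.

Lemma godel_eval (L : HA) (X : IA) (f : L -> X) (v : nat -> X) (w : nat -> L) (t : hterm) :
  open_hom L X f -> (forall i, f (w i) = iint X (v i)) ->
  ieval X v (godel t) = f (heval L w t).
Proof.
  intros Hf E; induction t; cbn; rewrite ?IHt1, ?IHt2; symmetry; try apply Hf; auto.
Qed.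

Lemma godel_bnd (n : nat) (t : hterm) : hbnd n t -> ibnd n (godel t).
Proof. induction t; cbn; tauto. Qed.

(** The translation of an equation of V holds in every B(M) with M in V, because interiors there
    come from M. It therefore holds in X, where at open values it is the original equation read in
    O(X). *)
Lemma opens_in_variety (V : HA -> Prop) (X : IA) :
  @is_variety HSig V -> rho_star V X -> V (opens X).
Proof.
  intros [E HE] HX; apply HE; intros [s t] Hst v; cbn in *; cbn in v.
  apply open_val_inj.
  assert (G : forall r, open_val X (heval (opens X) v r)
                        = ieval X (fun i => open_val X (v i)) (godel r)).
  { intro r; symmetry; apply godel_eval; [apply open_val_hom|].
    intro i; symmetry; apply (open_hom_open _ _ _ _ (open_val_hom X)). }
  rewrite !G; apply (HX (godel s, godel t)).
  intros B [M [VM HB]] w; cbn in *; cbn in w.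
  destruct (is_BL_embedding M B HB) as [e He]; pose proof (ble_hom He) as Hh.
  assert (ex : forall i, exists u, e u = iint B (w i)).
  { intro i; destruct (iint_cnf_open M B e (w i) Hh (ble_cnf He _)); eauto. }
  destruct (boolp.choice ex) as [w' Hw'].
  rewrite !(godel_eval M B e w w') by auto; f_equal.
  apply (proj1 (HE M) VM (s, t) Hst).
Qed.

Lemma BL_in_rho_star (V : HA -> Prop) (L : HA) (B : IA) (e : L -> B) :
  V L -> BL_embedding L B e -> rho_star V B.
Proof.
  intros VL He E HE; apply HE; exists L; split; auto; eapply embedding_is_BL; eauto.
Qed.

(** * Grzegorczyk's law *)

(* For a Boolean combination x of open elements this is the set of points near
   which x is closed; it is dense in x. *)
Definition grz_core (X : IA) (x : X) : X :=
  let o := iint X (icompl X x) in imeet X (icompl X o) (iint X (ijoin X o x)).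

Lemma grz_BL (L : HA) (B : IA) (e : L -> B) (x : B) :
  BL_embedding L B e -> imeet B x (iint B (icompl B (grz_core B x))) = i0 B.
Proof.
  intros He; pose proof (ble_hom He) as Hh.
  destruct (ble_cnf He (icompl B x)) as [l Hl].
  unfold grz_core; set (o := iint B (icompl B x)).
  set (c := iint B (ijoin B o x)); set (w := iint B _).
  assert (Hw : iint B w = w) by apply iint_idem.
  assert (wy : imeet B w (imeet B (icompl B o) c) = i0 B).
  { pose proof (iint_le B (icompl B (imeet B (icompl B o) c))) as K.
    fold w in K; clear - K; boolean B. }
  (* On the open set w, x is the complement of the clauses in l; they are
     discarded one at a time, working in w /\ e v first. *)
  assert (wl : imeet B w (icompl B x) = imeet B w (cnf e l)) by (rewrite Hl; reflexivity).
  clear Hl; clearbody w; revert w Hw wy wl.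
  induction l as [|[u v] l IH]; intros w Hw wy wl.
  - rewrite cnf_nil in wl; clear - wl; boolean B.
  - rewrite cnf_cons in wl.
    pose proof (open_hom_open L B e u Hh) as Hu.
    pose proof (open_hom_open L B e v Hh) as Hv.
    assert (xwv : imeet B x (imeet B w (e v)) = i0 B).
    { apply IH.
      - rewrite iint_meet, Hw, Hv; reflexivity.
      - clear - wy; boolean B.
      - clear - wl; boolean B. }
    (* An open set disjoint from [x] lies below [o]. *)
    assert (wvo : imeet B (imeet B w (e v)) o = imeet B w (e v)).
    { apply iint_glb; [rewrite iint_meet, Hw, Hv; reflexivity|].
      clear - xwv; boolean B. }
    (* Within [w] and [e u], the complement of [x] lies in [e v], hence in [o] by [wvo]; so this
       open set is below o + x and thus below [c]. *)
    assert (wuc : imeet B (imeet B w (e u)) c = imeet B w (e u)).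
    { apply iint_glb; [rewrite iint_meet, Hw, Hu; reflexivity|].
      clear - wvo wl; boolean B. }
    assert (ox : imeet B o (icompl B x) = o) by apply iint_le.
    apply IH; auto; clear - wuc wy wl ox; boolean B.
Qed.

(** Puts the law into the form of an equation with [I0], the shape in which it transfers from the
    generators to [rho_star V]. *)
Definition grz_term : iterm :=
  let o := IInt (ICompl (IVar 0)) in
  IMeet (IVar 0) (IInt (ICompl (IMeet (ICompl o) (IInt (IJoin o (IVar 0)))))).

Lemma grz_rho_star (V : HA -> Prop) (X : IA) (x : X) :
  rho_star V X -> imeet X x (iint X (icompl X (grz_core X x))) = i0 X.
Proof.
  intro HX; apply (HX (grz_term, I0)) with (v := fun _ => x).
  intros B [L [_ HB]] v; destruct (is_BL_embedding L B HB) as [e He].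
  apply (grz_BL L B e (v 0) He).
Qed.

(* By Grzegorczyk's law grz_core x is nonzero when x is, so splitting it off
   repeatedly exhausts x; and it is a Boolean combination of opens. *)
Lemma finite_BL_opens (V : HA -> Prop) (X : IA) (l : list X) :
  rho_star V X -> (forall x, In x l) -> BL_embedding (opens X) X (open_val X).
Proof.
  intros HX Hl; pose proof (open_val_hom X) as Ho.
  split; auto using open_val_inj; intro x.
  assert (gen : forall y, in_cnf (open_val X) (iint X y)).
  { intro y; rewrite <- open_of_val; apply in_cnf_gen, Ho. }
  (* The list [l'] contains all nonzero elements below [x], possibly with repetitions and extras;
     its length is the induction measure. *)
  assert (main : forall n l', length l' <= n ->
    forall x, (forall y, imeet X y x = y -> y = i0 X \/ In y l') ->
    in_cnf (open_val X) x).
  { clear x; induction n as [|n IH]; intros l' Hn x Hx.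
    - destruct l'; [| cbn in Hn; lia].
      destruct (Hx x) as [-> | []].
      + clear; boolean X.
      + rewrite <- iint_0; apply gen.
    - set (y := grz_core X x).
      assert (Hy : in_cnf (open_val X) y).
      { apply in_cnf_meet; auto; apply in_cnf_compl; auto. }
      pose proof (grz_rho_star V X x HX) as G; fold y in G.
      assert (yx : imeet X y x = y).
      { pose proof (iint_le X (ijoin X (iint X (icompl X x)) x)) as K.
        unfold y, grz_core; clear - K; boolean X. }
      destruct (boolp.EM (x = i0 X)) as [-> | nx]; [rewrite <- iint_0; apply gen|].
      assert (xl : In x l').
      { destruct (Hx x); [clear; boolean X | contradiction | assumption]. }
      destruct (in_split x l' xl) as [l1 [l2 ->]].
      replace x with (ijoin X y (imeet X x (icompl X y))) by (clear - yx; boolean X).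
      apply in_cnf_join; auto; apply (IH (l1 ++ l2)).
      + rewrite length_app in *; cbn in Hn; lia.
      + intros z Hz.
        destruct (Hx z) as [-> | Iz]; [clear - Hz; boolean X | auto |].
        apply in_app_iff in Iz; destruct Iz as [Iz | [<- | Iz]].
        * right; apply in_app_iff; auto.
        (* Here [z] is [x] itself, so [x] is disjoint from its core and the core is 0; the law then
           forces x = 0. Hence removing [x] from the list is legitimate. *)
        * exfalso; apply nx.
          assert (y0 : y = i0 X) by (clear - yx Hz; boolean X).
          rewrite y0 in G; rewrite <- G.
          replace (icompl X (i0 X)) with (i1 X) by (clear; boolean X).
          rewrite iint_1, imeet_1; reflexivity.
        * right; apply in_app_iff; auto. }
  apply (main (length l) l); auto.
Qed.

(** * Finitely presented and projective algebras *)

Lemma in_cnf_term (L : HA) (B : IA) (e : L -> B) (n : nat) (a : nat -> L) (x : B) :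
  BL_embedding L B e -> (forall u, exists t, hbnd n t /\ heval L a t = u) ->
  exists t, ibnd n t /\ ieval B (fun i => e (a i)) t = x.
Proof.
  intros He gen; pose proof (ble_hom He) as Hh.
  assert (G : forall u, exists t, ibnd n t /\ ieval B (fun i => e (a i)) t = e u).
  { intro u; destruct (gen u) as [t [bt <-]]; exists (godel t).
    split; [apply godel_bnd; auto|].
    apply godel_eval; auto; intro i; symmetry; eapply open_hom_open; eauto. }
  destruct (ble_cnf He x) as [l <-]; induction l as [|[u v] l [t [bt Et]]].
  - exists I1; split; cbn; auto.
  - destruct (G u) as [s [bs Es]], (G v) as [r [br Er]].
    exists (IMeet (IJoin (ICompl s) r) t); split; cbn; auto.
    rewrite Es, Er, Et, cnf_cons; reflexivity.
Qed.

(** The presentation keeps the generators, translates the relations, and adds that every generator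
    is open. The last relations ensure that a homomorphism obtained from the interiors of the [b i]
    sends the generators to the [b i] themselves. *)
Lemma BL_fin_pres (V : HA -> Prop) (P : HA) (B : IA) (e : P -> B) :
  @is_variety HSig V -> BL_embedding P B e ->
  @fin_pres HSig V P -> @fin_pres ISig (rho_star V) B.
Proof.
  intros HV He [VP [n [a [rels [bnds [sat [gen univ]]]]]]]; cbn in *.
  pose proof (ble_hom He) as Hh.
  split; [eapply BL_in_rho_star; eauto|].
  exists n, (fun i => e (a i)),
    (map (fun p => (godel (fst p), godel (snd p))) rels
     ++ map (fun i => (IInt (IVar i), IVar i)) (seq 0 n)); cbn.
  assert (op : forall i, iint B (e (a i)) = e (a i))
    by (intro; eapply open_hom_open; eauto).
  split; [|split; [|split]].
  - intros p Hp; apply in_app_iff in Hp; destruct Hp as [Hp | Hp];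
      apply in_map_iff in Hp.
    + destruct Hp as [[s t] [<- Hst]]; cbn.
      destruct (bnds _ Hst); split; apply godel_bnd; auto.
    + destruct Hp as [i [<- Hi]]; apply in_seq in Hi; cbn; lia.
  - intros p Hp; apply in_app_iff in Hp; destruct Hp as [Hp | Hp];
      apply in_map_iff in Hp.
    + destruct Hp as [[s t] [<- Hst]]; cbn.
      rewrite !(godel_eval P B e _ a) by auto; f_equal; apply (sat _ Hst).
    + destruct Hp as [i [<- Hi]]; cbn; auto.
  - intro x; apply (in_cnf_term P B e n a x He gen).
  - intros C HC b Hb.
    assert (ev : forall t, ieval C b (godel t)
              = open_val C (heval (opens C) (fun i => open_of C (b i)) t)).
    { intro t; apply godel_eval; [apply open_val_hom | reflexivity]. }
    destruct (univ (opens C) (opens_in_variety V C HV HC) (fun i => open_of C (b i)))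
      as [f [Hf fa]].
    { intros p Hp; apply open_val_inj; rewrite <- !ev.
      apply (Hb (godel (fst p), godel (snd p))).
      apply in_app_iff; left; apply in_map_iff; eauto. }
    destruct (BL_extend P B C e (fun u => open_val C (f u)) He) as [F [HF EF]].
    { apply (hhom_open_comp P (opens C) C); auto; apply open_val_hom. }
    exists F; split; auto; intros i Hi; rewrite EF, fa, open_of_val by auto.
    apply (Hb (IInt (IVar i), IVar i)).
    apply in_app_iff; right; apply in_map_iff; exists i; split; auto.
    apply in_seq; lia.
Qed.

Lemma opens_map (X Y : IA) (h : X -> Y) :
  ihom X Y h ->
  exists g, hhom (opens X) (opens Y) g /\
    forall u, open_val Y (g u) = h (open_val X u).
Proof.
  intro Hh; apply (opens_lift (opens X) Y (fun u => h (open_val X u))).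
  apply (open_hom_comp (opens X) X Y); auto using open_val_hom.
Qed.

Lemma ihom_comp (X Y Z : IA) (f : X -> Y) (g : Y -> Z) :
  ihom X Y f -> ihom Y Z g -> ihom X Z (fun x => g (f x)).
Proof.
  intros [f0 [f1 [fJ [fM [fC fI]]]]] [g0 [g1 [gJ [gM [gC gI]]]]].
  repeat split; intros; congruence.
Qed.

Lemma BL_projective (V : HA -> Prop) (P : HA) (B : IA) (e : P -> B) :
  @is_variety HSig V -> BL_embedding P B e ->
  @projective HSig V P -> @projective ISig (rho_star V) B.
Proof.
  intros HV He [VP proj]; pose proof (ble_hom He) as Hh; cbn in *.
  split; [eapply BL_in_rho_star; eauto|]; cbn.
  intros C D HC HD f Hf fsurj h Hhom.
  destruct (opens_map C D f Hf) as [fo [Hfo Efo]].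
  destruct (opens_lift P D (fun u => h (e u))) as [ho [Hho Eho]].
  { apply (open_hom_comp P B D); auto. }
  (* The interior of any preimage of an open element is an open preimage. *)
  assert (fosurj : forall y, exists x, fo x = y).
  { intro y; destruct (fsurj (open_val D y)) as [x Hx]; exists (open_of C x).
    apply open_val_inj; rewrite Efo, open_of_val.
    destruct Hf as [_ [_ [_ [_ [_ fI]]]]]; rewrite fI, Hx.
    apply (open_hom_open _ _ _ _ (open_val_hom D)). }
  destruct (proj (opens C) (opens D) (opens_in_variety V C HV HC)
    (opens_in_variety V D HV HD) fo Hfo fosurj ho Hho) as [k [Hk Ek]].
  destruct (BL_extend P B C e (fun u => open_val C (k u)) He) as [K [HK EK]].
  { apply (hhom_open_comp P (opens C) C); auto; apply open_val_hom. }
  exists K; split; auto.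
  apply (BL_ihom_ext P B D e (fun x => f (K x)) h He); auto.
  - apply (ihom_comp B C D); auto.
  - intro u; rewrite EK, <- Efo, Ek; apply Eho.
Qed.

Lemma fin_gen_finite (V : HA -> Prop) (X : IA) :
  @locally_finite ISig (rho_star V) -> @fin_pres ISig (rho_star V) X ->
  exists l : list X, forall x, In x l.
Proof.
  intros lf [HX [n [a [_ [_ [_ [gen _]]]]]]].
  destruct (lf X HX n a) as [l Hl]; exists l; intro x.
  destruct (gen x) as [t [bt <-]]; auto.
Qed.

Lemma list_filter_prop (T : Type) (P : T -> Prop) (l : list T) :
  exists l', forall x, In x l' <-> In x l /\ P x.
Proof.
  induction l as [|y l [l' IH]].
  - exists []; cbn; tauto.
  - destruct (boolp.EM (P y)) as [Py | nPy].
    + exists (y :: l'); intro x; cbn; rewrite IH; split; [|tauto].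
      intros [<- | H]; tauto.
    + exists l'; intro x; cbn; rewrite IH; split; [tauto|].
      intros [[<- | H] Px]; tauto.
Qed.

Lemma opens_finite (X : IA) (l : list X) :
  (forall x, In x l) -> exists l' : list (opens X), forall x, In x l'.
Proof.
  intro Hl; exists (map (open_of X) l); intro x; apply in_map_iff.
  exists (open_val X x); split; auto; apply open_val_inj; rewrite open_of_val.
  apply (open_hom_open _ _ _ _ (open_val_hom X)).
Qed.

(* The generators are all elements, the relations all equations between terms
   of depth at most one. *)
Lemma finite_fin_pres (V : HA -> Prop) (L : HA) (l : list L) :
  V L -> (forall x, In x l) -> @fin_pres HSig V L.
Proof.
  intros VL Hl; split; auto; cbn.
  (* The default [htop L] is reached only at indices from [n] on, which no term bounded by [n]
     mentions. *)
  pose (n := length l); pose (a := fun i => nth i l (htop L)).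
  assert (ex : forall x, exists i, i < n /\ a i = x).
  { intro x; apply In_nth; apply Hl. }
  destruct (boolp.choice ex) as [idx Hidx].
  pose (pairs := list_prod (seq 0 n) (seq 0 n)).
  pose (terms := HBot :: HTop :: map HVar (seq 0 n)
    ++ map (fun ij => HJoin (HVar (fst ij)) (HVar (snd ij))) pairs
    ++ map (fun ij => HMeet (HVar (fst ij)) (HVar (snd ij))) pairs
    ++ map (fun ij => HImp (HVar (fst ij)) (HVar (snd ij))) pairs).
  assert (inT : forall i j, i < n -> j < n ->
    In (HVar i) terms /\ In (HJoin (HVar i) (HVar j)) terms /\
    In (HMeet (HVar i) (HVar j)) terms /\ In (HImp (HVar i) (HVar j)) terms).
  { intros i j Hi Hj.
    assert (Pi : In i (seq 0 n)) by (apply in_seq; lia).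
    assert (Pij : In (i, j) pairs) by (apply in_prod; apply in_seq; lia).
    unfold terms; cbn [In]; rewrite !in_app_iff, !in_map_iff.
    repeat split; do 2 right; [left | right; left | do 2 right; left | do 3 right].
    - exists i; auto.
    - exists (i, j); auto.
    - exists (i, j); auto.
    - exists (i, j); auto. }
  assert (Tbnd : forall t, In t terms -> hbnd n t).
  { intros t; unfold terms, pairs; cbn [In]; rewrite !in_app_iff, !in_map_iff.
    intros [<- | [<- | [H | [H | [H | H]]]]]; cbn; auto;
      [destruct H as [i [<- Hi]]; apply in_seq in Hi; cbn; lia | ..];
      destruct H as [[i j] [<- Hij]]; apply in_prod_iff in Hij;
      rewrite !in_seq in Hij; cbn; lia. }
  destruct (list_filter_prop _ (fun p => heval L a (fst p) = heval L a (snd p))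
    (list_prod terms terms)) as [rels Hrels].
  exists n, a, rels; split; [|split; [|split]].
  - intros [s t] Hp; apply Hrels in Hp; destruct Hp as [Hp _].
    apply in_prod_iff in Hp; cbn; destruct Hp; auto.
  - intros p Hp; apply Hrels in Hp; tauto.
  - intro x; exists (HVar (idx x)); apply (Hidx x).
  - intros M _ b Hb; exists (fun x => b (idx x)).
    assert (use : forall s t, In s terms -> In t terms ->
      heval L a s = heval L a t -> heval M b s = heval M b t).
    { intros s t Hs Ht E; apply (Hb (s, t)), Hrels; split; auto.
      apply in_prod; auto. }
    assert (T0 : In HBot terms) by (left; auto).
    assert (T1 : In HTop terms) by (right; left; auto).
    assert (lt : forall x, idx x < n) by (intro; apply Hidx).
    assert (ai : forall x, a (idx x) = x) by (intro; apply Hidx).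
    assert (var : forall x, In (HVar (idx x)) terms)
      by (intro x; apply (inT (idx x) (idx x)); auto).
    repeat split.
    + apply (use (HVar _) HBot); auto; apply ai.
    + apply (use (HVar _) HTop); auto; apply ai.
    + intros x y; apply (use (HVar _) (HJoin (HVar _) (HVar _))); auto.
      * apply inT; auto.
      * cbn; rewrite !ai; reflexivity.
    + intros x y; apply (use (HVar _) (HMeet (HVar _) (HVar _))); auto.
      * apply inT; auto.
      * cbn; rewrite !ai; reflexivity.
    + intros x y; apply (use (HVar _) (HImp (HVar _) (HVar _))); auto.
      * apply inT; auto.
      * cbn; rewrite !ai; reflexivity.
    (* With repetitions in [l], [idx (a i)] may differ from [i]; the relations between two variables
       identify their values. *)
    + intros i Hi; apply (use (HVar _) (HVar i)); auto.
      * apply (inT i i); auto.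
      * cbn; apply ai.
Qed.

Lemma BL_map (L M : HA) (A B : IA) (d : L -> A) (e : M -> B) (f : L -> M) :
  BL_embedding L A d -> BL_embedding M B e -> hhom L M f ->
  exists F, ihom A B F /\ forall u, F (d u) = e (f u).
Proof.
  intros Hd He Hf; apply (BL_extend L A B d (fun u => e (f u)) Hd).
  apply (hhom_open_comp L M B); auto; apply He.
Qed.

Lemma BL_restrict (L M : HA) (A B : IA) (d : L -> A) (e : M -> B) (h : A -> B) :
  BL_embedding L A d -> BL_embedding M B e -> ihom A B h ->
  exists g, hhom L M g /\ forall u, e (g u) = h (d u).
Proof.
  intros Hd He Hh; apply (BL_lift_open L M B e (fun u => h (d u)) He).
  apply (open_hom_comp L A B); auto; apply Hd.
Qed.

(** The lifting problem is moved to [rho_star V] by B, which preserves surjections since normal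
    forms are lifted entry by entry; the solution restricts to P. *)
Lemma projective_of_BL (V : HA -> Prop) (P : HA) (C : IA) (e : P -> C) :
  V P -> BL_embedding P C e ->
  @projective ISig (rho_star V) C -> @projective HSig V P.
Proof.
  intros VP He [HC proj]; cbn in *; split; auto; cbn.
  intros A D VA VD f Hf fsurj h Hh.
  destruct (BL_exists A) as [BA [eA HeA]], (BL_exists D) as [BD [eD HeD]].
  destruct (BL_map A D BA BD eA eD f HeA HeD Hf) as [F [HF EF]].
  destruct (BL_map P D C BD e eD h He HeD Hh) as [H [HH EH]].
  assert (Fsurj : forall y, exists x, F x = y).
  { intro y; destruct (ble_cnf HeD y) as [l <-], (boolp.choice fsurj) as [g Hg].
    exists (cnf (fun u => eA (g u)) l); rewrite ihom_cnf by exact HF.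
    f_equal; apply boolp.funext; intro u; rewrite EF, Hg; reflexivity. }
  destruct (proj BA BD (BL_in_rho_star V A BA eA VA HeA)
    (BL_in_rho_star V D BD eD VD HeD) F HF Fsurj H HH) as [K [HK EK]].
  destruct (BL_restrict P A C BA e eA K He HeA HK) as [k [Hk Ek]].
  exists k; split; auto; intro x; apply (ble_inj HeD).
  rewrite <- EF, Ek, EK; apply EH.
Qed.

(** * Unification types *)

(* An equivalence of the two quasiordered sets of unifiers, given as a
   correspondence. *)
Definition correspondence (S S' : Sig) (W : alg S -> Prop) (W' : alg S' -> Prop)
  (A : alg S) (A' : alg S') (R : unifier S W A -> unifier S' W' A' -> Prop) : Prop :=
  (forall U : unifier S W A, more_general U U) /\
  (forall U : unifier S' W' A', more_general U U) /\
  (forall U, exists U', R U U') /\ (forall U', exists U, R U U') /\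
  (forall U V U' V', R U U' -> R V V' -> (more_general U V <-> more_general U' V')).

Lemma correspondence_sym (S S' : Sig) (W : alg S -> Prop) (W' : alg S' -> Prop)
  (A : alg S) (A' : alg S') (R : unifier S W A -> unifier S' W' A' -> Prop) :
  correspondence S S' W W' A A' R ->
  correspondence S' S W' W A' A (fun U' U => R U U').
Proof.
  intros [rX [rY [tl [tr ord]]]]; repeat split; auto; apply (ord _ _ _ _ H H0).
Qed.

Definition bijection_on (X Y : Type) (M : X -> Prop) (N : Y -> Prop)
  (R : X -> Y -> Prop) : Prop :=
  (forall x, M x -> exists y, N y /\ R x y) /\
  (forall y, N y -> exists x, M x /\ R x y) /\
  (forall x y y', M x -> N y -> N y' -> R x y -> R x y' -> y = y') /\
  (forall x x' y, M x -> M x' -> N y -> R x y -> R x' y -> x = x').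

Lemma bijection_on_sym (X Y : Type) (M : X -> Prop) (N : Y -> Prop) (R : X -> Y -> Prop) :
  bijection_on X Y M N R -> bijection_on Y X N M (fun y x => R x y).
Proof. intros [tl [tr [ul ur]]]; repeat split; eauto. Qed.

Lemma finite_bijection (X Y : Type) (M : X -> Prop) (N : Y -> Prop) (R : X -> Y -> Prop) :
  bijection_on X Y M N R -> finite_set M -> finite_set N.
Proof.
  intros [tl [tr [ul ur]]] [l Hl].
  assert (E : exists l', forall x y, M x -> In x l -> N y -> R x y -> In y l').
  { clear Hl; induction l as [|a l [l' IH]].
    - exists []; cbn; tauto.
    - destruct (boolp.EM (M a)) as [Ma | nMa].
      + destruct (tl a Ma) as [b [Nb Rab]]; exists (b :: l').
        intros x y Mx [<- | Ix] Ny Rxy; [left | right]; eauto.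
      + exists l'; intros x y Mx [<- | Ix] Ny Rxy; [contradiction | eauto]. }
  destruct E as [l' Hl']; exists l'; intros y Ny.
  destruct (tr y Ny) as [x [Mx Rxy]]; eauto.
Qed.

(** One partner is chosen for each member of M. All partners of a unifier are mutually comparable,
    so any choice serves for density. *)
Lemma mu_set_transfer (S S' : Sig) (W : alg S -> Prop) (W' : alg S' -> Prop)
  (A : alg S) (A' : alg S') (R : unifier S W A -> unifier S' W' A' -> Prop)
  (M : unifier S W A -> Prop) :
  correspondence S S' W W' A A' R -> mu_set M ->
  exists N : unifier S' W' A' -> Prop, mu_set N /\ bijection_on _ _ M N R.
Proof.
  intros [rX [rY [tl [tr ord]]]] [anti dense].
  destruct (boolp.choice tl) as [F HF].
  exists (fun U' => exists U, M U /\ U' = F U).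
  assert (anti' : forall U V, M U -> M V -> more_general (F U) (F V) -> U = V).
  { intros U V MU MV ge; apply anti; auto; apply (ord U V (F U) (F V)); auto. }
  split; [split|split; [|split; [|split]]].
  - intros _ _ [U [MU ->]] [V [MV ->]] ge; f_equal; auto.
  - intro V'; destruct (tr V') as [V RV], (dense V) as [U [MU ge]].
    exists (F U); split; eauto; apply (ord U V); auto.
  - eauto.
  - intros _ [U [MU ->]]; eauto.
  - intros U _ _ MU [V [MV ->]] [V' [MV' ->]] RV RV'; f_equal.
    (* [F V] and [F V'] are both partners of [U], so reflexivity at [U] makes them comparable. *)
    apply anti'; auto; apply (ord U U); auto.
  - intros U V V' MU MV _ RU RV; apply anti; auto; apply (ord U V V' V'); auto.
Qed.

Lemma utype_transfer (S S' : Sig) (W : alg S -> Prop) (W' : alg S' -> Prop)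
  (A : alg S) (A' : alg S') (R : unifier S W A -> unifier S' W' A' -> Prop) (t : utype) :
  correspondence S S' W W' A A' R -> has_utype S W A t -> has_utype S' W' A' t.
Proof.
  intros HR; destruct t; cbn.
  - intros [M [HM [U HU]]].
    destruct (mu_set_transfer _ _ _ _ _ _ R M HR HM) as [N [HN [tl [tr [ul ur]]]]].
    exists N; split; auto.
    assert (MU : M U) by (apply HU; auto).
    destruct (tl U MU) as [U' [NU' RU]]; exists U'.
    intro V'; split; [|intros ->; auto].
    intro NV'; destruct (tr V' NV') as [V [MV RV]].
    apply HU in MV as ->; eauto.
  - intros [M [HM [fin [U [V [MU [MV neq]]]]]]].
    destruct (mu_set_transfer _ _ _ _ _ _ R M HR HM) as [N [HN bij]].
    exists N; split; [|split]; eauto using finite_bijection.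
    destruct bij as [tl [tr [ul ur]]].
    destruct (tl U MU) as [U' [NU RU]], (tl V MV) as [V' [NV RV]].
    exists U', V'; repeat split; auto; intros <-; eauto.
  - intros [M [HM inf]].
    destruct (mu_set_transfer _ _ _ _ _ _ R M HR HM) as [N [HN bij]].
    exists N; split; auto; intro fin; apply inf.
    eapply finite_bijection; [eapply bijection_on_sym; exact bij | exact fin].
  (* Nonexistence is contravariant, so the transfer runs through the converse correspondence. *)
  - intros none [N HN]; apply none.
    destruct (mu_set_transfer _ _ _ _ _ _ _ N (correspondence_sym _ _ _ _ _ _ R HR) HN)
      as [M [HM _]]; eauto.
Qed.

(** Allowing any embedding [eU] covers both a constructed B(P) and a given algebra C over its own
    opens. *)
Definition BL_lift (V : HA -> Prop) (L : HA) (B : IA) (e : L -> B)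
  (U : @unifier HSig V L) (U' : @unifier ISig (rho_star V) B) : Prop :=
  exists eU : u_alg U -> u_alg U', BL_embedding (u_alg U) (u_alg U') eU /\
    forall x, u_map U' (e x) = eU (u_map U x).

Lemma BL_lift_more_general (V : HA -> Prop) (L : HA) (B : IA) (e : L -> B)
  (U1 U2 : @unifier HSig V L) (U1' U2' : @unifier ISig (rho_star V) B) :
  BL_embedding L B e -> BL_lift V L B e U1 U1' -> BL_lift V L B e U2 U2' ->
  (more_general U1 U2 <-> more_general U1' U2').
Proof.
  intros He [e1 [H1 E1]] [e2 [H2 E2]]; split; intros [h [Hh Eh]]; cbn in *.
  - destruct (BL_map _ _ _ _ e1 e2 h H1 H2 Hh) as [H [HH EH]].
    exists H; split; auto.
    (* The triangle need only commute on the image of L, which generates B. *)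
    apply (BL_ihom_ext L B (u_alg U2') e (u_map U2') (fun x => H (u_map U1' x)) He).
    + apply U2'.
    + apply (ihom_comp B (u_alg U1') (u_alg U2')); auto; apply U1'.
    + intro x; rewrite E1, E2, EH; f_equal; apply Eh.
  - destruct (BL_restrict _ _ _ _ e1 e2 h H1 H2 Hh) as [g [Hg Eg]].
    exists g; split; auto; intro x; apply (ble_inj H2).
    rewrite Eg, <- E1, <- Eh; symmetry; apply E2.
Qed.

Theorem theorem5p7 (V : HA -> Prop)
  (HV : @is_variety HSig V)
  (Hlf : @locally_finite ISig (rho_star V))
  (L : HA) (HL : V L) (HLfp : @fin_pres HSig V L)
  (B : IA) (HB : is_BL L B) :
  forall t : utype,
    @has_utype HSig V L t <-> @has_utype ISig (rho_star V) B t.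
Proof.
  destruct (is_BL_embedding L B HB) as [e He].
  assert (HR : correspondence HSig ISig V (rho_star V) L B (BL_lift V L B e)).
  { split; [|split; [|split; [|split]]].
    - intro U; exists (fun x => x); repeat split; auto.
    - intro U; exists (fun x => x); repeat split; auto.
    - intros [P Pfp Pproj u Hu]; cbn in *.
      destruct (BL_exists P) as [BP [eP HP]].
      destruct (BL_map L P B BP e eP u He HP Hu) as [F [HF EF]].
      exists (@MkUnifier ISig (rho_star V) B BP (BL_fin_pres V P BP eP HV HP Pfp)
        (BL_projective V P BP eP HV HP Pproj) F HF).
      exists eP; auto.
    - intros [C Cfp Cproj v Hv]; cbn in *.
      destruct (fin_gen_finite V C Hlf Cfp) as [l Hl].
      pose proof (finite_BL_opens V C l (proj1 Cfp) Hl) as HC.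
      pose proof (opens_in_variety V C HV (proj1 Cfp)) as VC.
      destruct (opens_finite C l Hl) as [l' Hl'].
      destruct (BL_restrict L (opens C) B C e (open_val C) v He HC Hv) as [u [Hu Eu]].
      exists (@MkUnifier HSig V L (opens C) (finite_fin_pres V (opens C) l' VC Hl')
        (projective_of_BL V (opens C) C (open_val C) VC HC Cproj) u Hu).
      exists (open_val C); split; auto.
    - intros; apply (BL_lift_more_general V L B e); auto. }
  intro t; split.
  - apply utype_transfer with (1 := HR).
  - apply utype_transfer with (1 := correspondence_sym _ _ _ _ _ _ _ HR).
Qed.
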